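(* Let $\alpha\in(0,1)$ be irrational. Given any limit $\ell\in\mathbb{Z}_{\ge0}\cup\{\infty\}$ and any right-admissible digit string $\langle b_k\rangle_{1}^\ell$, we have $\sum_{k=1}^\ell b_k|\theta_{k-1}|\in[0,1)$. Furthermore, for every intercept $\beta\in[0,1)$ there exist a unique limit $\ell\in\mathbb{Z}_{\ge0}\cup\{\infty\}$ and right-admissible digit string $\langle b_k\rangle_1^\ell$ such that $\beta=\sum_{k=1}^\ell b_k|\theta_{k-1}|$ (so that intercepts and right-admissible digit strings are in one-to-one correspondence).
   Context: For irrational $\alpha\in(0,1)$, set $\alpha_0=\alpha$ and, for $k\ge1$, $a_k=\lfloor 1/\alpha_{k-1}\rfloor$, $\alpha_k=1/\alpha_{k-1}-a_k$ (the continued fraction digits of $\alpha$). Let $p_{-1}=1,\ p_0=0,\ p_k=a_kp_{k-1}+p_{k-2}$ and $q_{-1}=0,\ q_0=1,\ q_k=a_kq_{k-1}+q_{k-2}$ for $k\ge1$, and $\theta_k=q_k\alpha-p_k$ for $k\ge-1$. For $\ell\in\mathbb{Z}_{\ge0}\cup\{\infty\}$ (with $\infty-1=\infty$), an integer sequence $\langle b_k\rangle_1^\ell$ (empty if $\ell=0$, the vacuous expansion of $0$; indexed by all $k\ge1$ if $\ell=\infty$) is a right-admissible digit string if (i) $0\le b_k\le a_k$ for all $k$, and $b_\ell\ge1$; when $\ell=\infty$ the condition $b_\ell\ge1$ is read as $\limsup_k b_k\ge1$, i.e. the string does not end with a tail of zeros; (ii) $b_k=a_k\implies b_{k+1}=0$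 for all $1\le k<\ell-1$; (iii) if $\ell=\infty$, then $b_k\le a_k-1$ for infinitely many odd and infinitely many even indices $k$.
   Formalization: Condition (ii), that b_k = a_k implies b_{k+1} = 0, is imposed for all 1 ≤ k ≤ ℓ−1 rather than 1 ≤ k < ℓ−1; with the printed range the claim is false, since for ℓ = 2 the string (a_1, 1) would be admissible with sum 1. *)

(* Defs.v *)
From mathcomp Require Import all_boot all_order all_algebra.
From mathcomp Require Import all_classical all_reals all_analysis.

Set Implicit Arguments.
Unset Strict Implicit.
Unset Printing Implicit Defensive.

Import Order.TTheory GRing.Theory Num.Theory.
Import numFieldNormedType.Exports.

Local Open Scope classical_set_scope.
Local Open Scope ring_scope.

Section ContinuedFraction.
Variables (R : realType) (alpha : R).

(* alpha_k *)
Fixpoint cf_rem (k : nat) : R :=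
  if k is k'.+1 then (cf_rem k')^-1 - (Num.floor (cf_rem k')^-1)%:~R
  else alpha.

(* a_k, meaningful for k >= 1 only *)
Definition cf_digit (k : nat) : int := Num.floor (cf_rem k.-1)^-1.

(* The sequences p, q and theta start at index -1, so they are stored with a
   shift: [p_pred k] is p_{k-1}, [q_pred k] is q_{k-1} and [theta_pred k] is
   theta_{k-1}. *)
Fixpoint p_pred (k : nat) : int :=
  match k with
  | 0 => 1
  | 1 => 0
  | (k''.+1 as k').+1 => cf_digit k' * p_pred k' + p_pred k''
  end.

Fixpoint q_pred (k : nat) : int :=
  match k with
  | 0 => 0
  | 1 => 1
  | (k''.+1 as k').+1 => cf_digit k' * q_pred k' + q_pred k''
  end.

Definition theta_pred (k : nat) : R :=
  (q_pred k)%:~R * alpha - (p_pred k)%:~R.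

End ContinuedFraction.

(* A limit l in {0, 1, 2, ...} U {oo} is an [option nat], [None] being oo.
   Digits are stored from position 0 on, but [digit b k] is b_k with k >= 1, so
   that [digits l] has no entry outside the range 1 <= k <= l and Leibniz
   equality of strings is equality of the sequences (b_k)_{1 <= k <= l}. *)
Definition digits (l : option nat) : Type :=
  if l is Some n then n.-tuple int else nat -> int.

Definition digit (l : option nat) : digits l -> nat -> int :=
  match l return digits l -> nat -> int with
  | Some n => fun b k => nth 0 (b : n.-tuple int) k.-1
  | None => fun b k => b k.-1
  end.

Definition in_range (l : option nat) (k : nat) : bool :=
  (1 <= k)%N && (if l is Some n then (k <= n)%N else true).

(* The second condition is imposed on every pair of consecutive digits b_k,
   b_{k+1} of the string, the last pair k + 1 = l included.  It cannot be
   dropped for that pair: the string (a_1, 1) would have sum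
   a_1 |theta_0| + |theta_1| = |theta_{-1}| = 1. *)
Definition right_admissible (R : realType) (alpha : R) (l : option nat)
    (b : digits l) : Prop :=
  [/\ (forall k, in_range l k -> 0 <= digit b k <= cf_digit alpha k)
      /\ (if l is Some n then (1 <= n)%N -> 1 <= digit b n
          else forall N : nat, exists2 k, (N <= k)%N & 1 <= digit b k),
      forall k, in_range l k -> in_range l k.+1 ->
        digit b k = cf_digit alpha k -> digit b k.+1 = 0
    & l = None ->
        (forall N : nat, exists k, [/\ (N <= k)%N, odd k
            & digit b k <= cf_digit alpha k - 1])
        /\ (forall N : nat, exists k, [/\ (N <= k)%N, ~~ odd k
            & digit b k <= cf_digit alpha k - 1])].

Definition ostrowski_psum (R : realType) (alpha : R) (l : option nat)
    (b : digits l) (n : nat) : R :=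
  \sum_(1 <= k < n.+1) (digit b k)%:~R * `|theta_pred alpha k|.

(* x = sum_{k=1}^l b_k |theta_{k-1}|, convergence being part of the claim when
   l is infinite. *)
Definition ostrowski_sum_is (R : realType) (alpha : R) (l : option nat)
    (b : digits l) (x : R) : Prop :=
  if l is Some n then ostrowski_psum alpha b n = x
  else ostrowski_psum alpha b n @[n --> \oo] --> x.

(* Main.v *)
(* The numbers D_k = |theta_{k-1}| are the products alpha_0 ... alpha_{k-1}, so
   they satisfy D_{k-1} = a_k D_k + D_{k+1}.  Hence every block of an
   admissible expansion starting at index k sums to less than D_{k-1}: either
   b_k < a_k, or b_k = a_k and b_{k+1} = 0, and one recurses.  For infinite
   sums the inequality stays strict, since equality would force b_k = a_k at
   all indices of one parity.  Each digit is therefore the integer part of the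
   remainder divided by D_k, which gives uniqueness, and the greedy algorithm
   gives existence.  Finite strings are treated as infinite ones padded with
   zeros. *)

Require Import Defs.
From mathcomp Require Import all_boot all_order all_algebra.
From mathcomp Require Import all_classical all_reals all_analysis.
From mathcomp Require Import ring lra.

Set Implicit Arguments.
Unset Strict Implicit.
Unset Printing Implicit Defensive.

Import Order.TTheory GRing.Theory Num.Theory.
Import numFieldNormedType.Exports.

Local Open Scope classical_set_scope.
Local Open Scope ring_scope.

(** * Expansions along an abstract sequence [D]: bounds and uniqueness *)

(* Indices are shifted to start at 0: [a k] is a_{k+1}, [c k] is b_{k+1}, and
   [D k] is |theta_{k-1}|. *)
Section Expansion.
Variables (R : realType) (a : nat -> int) (D : nat -> R).
Hypotheses (a_ge1 : forall k, 1 <= a k) (D_gt0 : forall k, 0 < D k).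
Hypothesis D_rec : forall k, D k = (a k)%:~R * D k.+1 + D k.+2.

(** Letting [m] range over all indices treats both parities of condition (iii) at once. Tails of
    zeros are allowed, so that padded finite strings qualify. *)
Definition admissible (c : nat -> int) : Prop :=
  [/\ forall k, 0 <= c k <= a k,
      forall k, c k = a k -> c k.+1 = 0
    & forall m, exists j, c (m + j.*2)%N < a (m + j.*2)%N].

Definition psum (c : nat -> int) (n : nat) : R :=
  \sum_(k < n) (c k)%:~R * D k.+1.

Lemma psumS c n : psum c n.+1 = psum c n + (c n)%:~R * D n.+1.
Proof. by rewrite /psum big_ord_recr. Qed.

Lemma D_ge_add k : D k.+1 + D k.+2 <= D k.
Proof.
by rewrite (D_rec k) lerD2r ler_peMl ?(ltW (D_gt0 _))// ler1z.
Qed.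

(** [D] decreases to some limit L >= 0, and passing to the limit in [D_ge_add] gives 2L <= L. *)
Lemma D_cvg0 : D @ \oo --> 0.
Proof.
have Dcvg : cvgn D.
  apply: nonincreasing_is_cvgn.
    apply/nonincreasing_seqP => k.
    by have := D_ge_add k; have := D_gt0 k.+2; lra.
  by exists 0 => _ [k _ <-]; rewrite ltW.
have limD0 : 0 <= limn D by apply: limr_ge => //; near=> k; rewrite ltW.
have D1 : D n.+1 @[n --> \oo] --> limn D by rewrite (cvg_shiftS D).
have D2 : D n.+2 @[n --> \oo] --> limn D by rewrite (cvg_shiftS (fun n => D n.+1)).
have : limn D + limn D <= limn D.
  apply: (ler_cvg_to (cvgD D1 D2) Dcvg).
  by near=> k; exact: D_ge_add.
move=> limD2; have -> : 0 = limn D by lra.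
exact: Dcvg.
Unshelve. all: by end_near.
Qed.

Lemma digit_le_pred c k : c k <= a k -> c k <> a k ->
  (c k)%:~R <= (a k)%:~R - 1 :> R.
Proof.
move=> ck ne; have : c k + 1 <= a k.
  by rewrite lezD1 lt_neqAle ck andbT; apply/eqP.
by rewrite -(ler_int R) intrD; lra.
Qed.

Lemma block_lt c m n : admissible c ->
  \sum_(m <= k < n) (c k)%:~R * D k.+1 < D m.
Proof.
case=> cb cz _.
(* The recursion advances by one index or, after a full digit and its zero, by two; hence induction
   on a bound [d] for the length. *)
suff H d : forall m n, (n <= m + d)%N ->
    \sum_(m <= k < n) (c k)%:~R * D k.+1 < D m.
  by apply: (H n); rewrite leq_addl.
elim: d => [|d IH] {}m {}n nmd; have [nm|mn] := leqP n m;
  rewrite ?(big_geq nm)//; first by move: nmd; rewrite addn0 leqNgt mn.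
rewrite (big_ltn mn); have /andP[c0 cle] := cb m.
have Dm := D_gt0 m.+1; have Dm2 := D_gt0 m.+2; have Drec := D_rec m.
have [cm|cm] := pselect (c m = a m).
  have [nm1|mn1] := leqP n m.+1.
    by rewrite (big_geq nm1) cm; lra.
  rewrite (big_ltn mn1) (cz _ cm) cm mul0r.
  have : (n <= m.+2 + d)%N by apply: leq_trans nmd _; rewrite addSnnS leq_add2r.
  by move=> /IH; lra.
have := IH m.+1 n; rewrite addSnnS => /(_ nmd).
have := digit_le_pred cle cm.
by nra.
Qed.

Lemma psum_nd c : (forall k, 0 <= c k <= a k) -> nondecreasing_seq (psum c).
Proof.
move=> cb; apply/nondecreasing_seqP => n; rewrite psumS lerDl.
by rewrite mulr_ge0 ?(ltW (D_gt0 _))// ler0z; case/andP: (cb n).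
Qed.

Lemma psum_is_cvg c : admissible c -> cvgn (psum c).
Proof.
move=> adm; have [cb _ _] := adm.
apply: nondecreasing_is_cvgn; first exact: psum_nd.
exists (D 0) => _ [n _ <-].
by have := block_lt 0 n adm; rewrite big_mkord => /ltW.
Qed.

(** Passing to the limit in [block_lt] only gives a weak upper bound. A tail attaining it at [m]
    attains it at every [m + j.*2], with full digits there, against the third admissibility
    condition. *)
Lemma tail_itv c x m : admissible c -> psum c @ \oo --> x ->
  0 <= x - psum c m < D m.
Proof.
move=> adm cx; have [cb cz cinf] := adm.
have psumx n : psum c n <= x.
  by rewrite -(cvg_lim _ cx)//; apply: nondecreasing_cvgn_le;
    [exact: psum_nd|apply/cvg_ex; exists x].
have weak n : x - psum c n <= D n.
  rewrite lerBlDl; apply: (cvgr_to_le cx); near=> p.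
  have np : (n <= p)%N by near: p; exact: nbhs_infty_ge.
  rewrite /psum -!(big_mkord xpredT (fun k => (c k)%:~R * D k.+1)).
  by rewrite (big_cat_nat _ np)//= lerD2l ltW// block_lt.
rewrite subr_ge0 psumx /= ltNge; apply/negP => full.
have step n : D n <= x - psum c n -> c n = a n /\ D n.+2 <= x - psum c n.+2.
  move=> fulln; have w1 := weak n.+1; have Drec := D_rec n.
  have Dn1 := D_gt0 n.+1; have Dn2 := D_gt0 n.+2.
  have /andP[_ cle] := cb n; move: w1; rewrite !psumS => w1.
  have [cn|cn] := pselect (c n = a n).
    by split=> //; rewrite (cz _ cn) cn; lra.
  (* A smaller digit would leave a tail of at least D_{n+1} + D_{n+2} at n+1, beyond the weak bound
     D_{n+1}. *)
  have := digit_le_pred cle cn; by nra.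
have fullj j : D (m + j.*2)%N <= x - psum c (m + j.*2)%N.
  elim: j => [|j IH]; first by rewrite addn0.
  by rewrite doubleS !addnS; apply: (step _ IH).2.
have [j] := cinf m.
by rewrite (step _ (fullj j)).1 ltxx.
Unshelve. all: by end_near.
Qed.

Lemma digit_tailE c x k : admissible c -> psum c @ \oo --> x ->
  c k = Num.floor ((x - psum c k) / D k.+1).
Proof.
move=> adm cx; have := tail_itv k.+1 adm cx; rewrite psumS.
move=> /andP[t0 t1]; apply/esym/floor_def.
rewrite ler_pdivlMr// ltr_pdivrMr// intrD mulrDl mul1r.
by apply/andP; split; lra.
Qed.

Lemma admissible_inj c c' (x : R) : admissible c -> admissible c' ->
  psum c @ \oo --> x -> psum c' @ \oo --> x -> c = c'.
Proof.
move=> adm adm' cx cx'.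
have psumE k : psum c k = psum c' k.
  elim: k => [|k IH]; first by rewrite /psum !big_ord0.
  by rewrite !psumS IH (digit_tailE _ adm cx) (digit_tailE _ adm' cx') IH.
apply/funext => k.
by rewrite (digit_tailE _ adm cx) (digit_tailE _ adm' cx') psumE.
Qed.

(** * The greedy algorithm and existence *)

Fixpoint greedy_rem (x : R) (k : nat) : R :=
  if k is k'.+1 then
    greedy_rem x k' - (Num.floor (greedy_rem x k' / D k))%:~R * D k
  else x.

Definition greedy_digit (x : R) (k : nat) : int :=
  Num.floor (greedy_rem x k / D k.+1).

Lemma greedy_remE x k : greedy_rem x k = x - psum (greedy_digit x) k.
Proof.
elim: k => [|k IH]; first by rewrite /psum big_ord0 subr0.
by rewrite psumS opprD addrA -IH.
Qed.

Lemma greedy_rem_itv x k : 0 <= x < D 0 -> 0 <= greedy_rem x k < D k.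
Proof.
move=> xD; case: k => // k /=.
have := floor_itv (greedy_rem x k / D k.+1).
rewrite ler_pdivlMr// ltr_pdivrMr// intrD mulrDl mul1r => /andP[? ?].
by apply/andP; split; lra.
Qed.

Lemma greedy_admissible x : 0 <= x < D 0 -> admissible (greedy_digit x).
Proof.
move=> xD; have itv k := greedy_rem_itv k xD.
have cb k : 0 <= greedy_digit x k <= a k.
  have /andP[r0 rD] := itv k; apply/andP; split.
    by rewrite floor_ge0 divr_ge0// ltW.
  rewrite -ltzD1 floor_lt_int ltr_pdivrMr// intrD mulrDl mul1r.
  (* Since D_{k+2} < D_{k+1}, the remainder is below D_k < (a_k + 1) D_{k+1}. *)
  by have := D_ge_add k.+1; have := D_gt0 k.+3; have := D_rec k; lra.
have cz k : greedy_digit x k = a k -> greedy_digit x k.+1 = 0.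
  move=> ck; have /andP[_ rD] := itv k; have /andP[r0 _] := itv k.+1.
  apply: floor_def; rewrite add0r ler_pdivlMr// ltr_pdivrMr// mul0r mul1r r0 /=.
  (* Removing a_k D_{k+1} from a remainder below D_k leaves less than D_{k+2}. *)
  by move: ck; rewrite /greedy_digit => ->; have := D_rec k; lra.
split=> // m; apply: contrapT => noj.
have full j : greedy_digit x (m + j.*2) = a (m + j.*2)%N.
  apply: contrapT => ne; apply: noj; exists j.
  have /andP[_ cle] := cb (m + j.*2)%N.
  by rewrite lt_neqAle cle andbT; apply/eqP.
(* The gap [D_k - r_k] is unchanged by a pair of digits [a_k, 0], whereas it is
   at most [D_k], which tends to 0. *)
have gap j : D (m + j.*2)%N - greedy_rem x (m + j.*2) = D m - greedy_rem x m.
  elim: j => [|j IH]; first by rewrite addn0.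
  rewrite -IH doubleS !addnS !greedy_remE !psumS (cz _ (full j)) full.
  by rewrite (D_rec (m + j.*2)); ring.
have gap_gt0 : 0 < D m - greedy_rem x m.
  by rewrite subr_gt0; case/andP: (itv m).
move/cvgrPdist_lt : D_cvg0 => /(_ _ gap_gt0) [N _ /(_ (m + N.*2)%N)] /=.
rewrite sub0r normrN gtr0_norm// -(gap N) -addnn addnCA => /(_ (leq_addr _ _)).
by case/andP: (itv (N + (m + N))%N) => r0 _; rewrite ltNge lerBlDr lerDl r0.
Qed.

Lemma greedy_cvg x : 0 <= x < D 0 -> psum (greedy_digit x) @ \oo --> x.
Proof.
move=> xD.
have r0 : greedy_rem x @ \oo --> 0.
  apply: (squeeze_cvgr _ (cvg_cst 0) D_cvg0); near=> k.
  by case/andP: (greedy_rem_itv k xD) => -> /ltW.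
have -> : psum (greedy_digit x) = (fun k => x - greedy_rem x k).
  by apply/funext => k; rewrite greedy_remE; ring.
rewrite -[X in _ --> X]subr0; apply: cvgB => //; exact: cvg_cst.
Unshelve. all: by end_near.
Qed.

End Expansion.

(** * The recurrence for |theta_k| from the continued fraction *)

Section ContinuedFractionFacts.
Variables (R : realType) (alpha : R).
Hypotheses (alpha01 : 0 < alpha < 1) (alpha_irr : irrational alpha).

Lemma irrational_inv_subz (x : R) (n : int) :
  irrational x -> irrational (x^-1 - n%:~R).
Proof.
move=> xirr [q _ qE]; apply: xirr; exists (q + n%:~R)^-1 => //.
by rewrite fmorphV rmorphD /= ratr_int qE subrK invrK.
Qed.

Lemma cf_rem_irrational k : irrational (cf_rem alpha k).
Proof. by elim: k => //= k; exact: irrational_inv_subz. Qed.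

Lemma cf_rem_itv k : 0 < cf_rem alpha k < 1.
Proof.
case: k => // k; have irr := @cf_rem_irrational k.+1.
rewrite lt_neqAle eq_sym -andbA; apply/and3P; split.
- by apply/eqP => r0; apply: irr; rewrite r0; exists 0 => //; rewrite rmorph0.
- by rewrite subr_ge0 floor_le.
- by rewrite ltrBlDl -intrD1 floorD1_gt.
Qed.

Lemma cf_digit_ge1 k : 1 <= cf_digit alpha k.+1.
Proof.
have /andP[r0 r1] := cf_rem_itv k.
by rewrite floor_ge_int invf_ge1// ltW.
Qed.

(** Both sides obey the same two-term recurrence, because a_{k+1} alpha_k = 1 - alpha_k alpha_{k+1};
    the induction therefore carries two consecutive indices. *)
Lemma theta_predE k :
  theta_pred alpha k = (-1) ^+ k.+1 * \prod_(i < k) cf_rem alpha i.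
Proof.
suff: theta_pred alpha k = (-1) ^+ k.+1 * \prod_(i < k) cf_rem alpha i /\
      theta_pred alpha k.+1 = (-1) ^+ k.+2 * \prod_(i < k.+1) cf_rem alpha i.
  by case.
elim: k => [|k [IH1 IH2]].
  by rewrite /theta_pred big_ord1 big_ord0 /= expr1 sqrrN expr1n; split; ring.
split=> //.
have -> : theta_pred alpha k.+2 =
    (cf_digit alpha k.+1)%:~R * theta_pred alpha k.+1 + theta_pred alpha k.
  by rewrite /theta_pred [q_pred _ _.+2]/= [p_pred _ _.+2]/= !intrD !intrM; ring.
rewrite IH1 IH2 !big_ord_recr /= -/(cf_digit alpha k.+1) !exprS.
have /andP[r0 _] := cf_rem_itv k.
by field; rewrite gt_eqF.
Qed.

Lemma norm_theta_predE k :
  `|theta_pred alpha k| = \prod_(i < k) cf_rem alpha i.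
Proof.
rewrite theta_predE normrM normrX normrN1 expr1n mul1r ger0_norm//.
by apply: prodr_ge0 => i _; case/andP: (cf_rem_itv i) => /ltW.
Qed.

Lemma norm_theta_pred_gt0 k : 0 < `|theta_pred alpha k|.
Proof.
rewrite norm_theta_predE; apply: prodr_gt0 => i _.
by case/andP: (cf_rem_itv i).
Qed.

Lemma norm_theta_pred0 : `|theta_pred alpha 0| = 1.
Proof. by rewrite norm_theta_predE big_ord0. Qed.

Lemma norm_theta_pred_rec k : `|theta_pred alpha k| =
  (cf_digit alpha k.+1)%:~R * `|theta_pred alpha k.+1| +
  `|theta_pred alpha k.+2|.
Proof.
rewrite !norm_theta_predE !big_ord_recr /= -/(cf_digit alpha k.+1).
have /andP[r0 _] := cf_rem_itv k.
by field; rewrite gt_eqF.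
Qed.

End ContinuedFractionFacts.

(* Reading a finite tuple past its end yields 0, so this pads finite strings
   with zeros; the padded strings are indexed from 0. *)
Definition padded (l : option nat) (b : digits l) (k : nat) : int :=
  digit b k.+1.

(** * Digit strings versus admissible sequences *)

Section Padding.
Variables (R : realType) (alpha : R).
Hypotheses (alpha01 : 0 < alpha < 1) (alpha_irr : irrational alpha).
Let a k := cf_digit alpha k.+1.
Let D k := `|theta_pred alpha k|.

Lemma padded_past_end n (b : digits (Some n)) k : (n <= k)%N -> padded b k = 0.
Proof. by move=> nk; apply: nth_default; rewrite size_tuple. Qed.

Lemma ostrowski_psumE l (b : digits l) n :
  ostrowski_psum alpha b n = psum D (padded b) n.
Proof. by rewrite /ostrowski_psum big_add1 big_mkord. Qed.

(** For a finite string the padded partial sums are constant from its length on, so the finite sum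
    is also their limit. *)
Lemma ostrowski_sum_isE l (b : digits l) x :
  ostrowski_sum_is alpha b x <-> psum D (padded b) @ \oo --> x.
Proof.
case: l b => [n|] b /=; last first.
  by under eq_fun do rewrite ostrowski_psumE.
have cst k : (n <= k)%N -> psum D (padded b) k = psum D (padded b) n.
  move=> nk; rewrite /psum.
  rewrite -!(big_mkord xpredT (fun i => (padded b i)%:~R * D i.+1)).
  rewrite (big_cat_nat _ nk)//= [X in _ + X]big1_seq ?addr0//.
  move=> i; rewrite mem_index_iota => /and3P[_ ni _].
  by rewrite nth_default ?size_tuple// mul0r.
have lim : psum D (padded b) @ \oo --> psum D (padded b) n.
  by apply: cvg_near_cst; exists n => // k /cst.
rewrite ostrowski_psumE; split => [<-//|bx].
exact: (cvg_unique _ lim bx).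
Qed.

Lemma padded_admissible l (b : digits l) :
  right_admissible alpha b -> admissible a (padded b).
Proof.
move=> [[bb bl] bz binf]; split.
- move=> k; case: l b bb {bl bz binf} => [n|] b bb; last exact: bb.
  have [nk|kn] := leqP n k; last exact: bb.
  rewrite padded_past_end// lexx.
  exact: le_trans (cf_digit_ge1 alpha01 alpha_irr k).
- move=> k; case: l b bb bl bz binf => [n|] b bb bl bz binf; last exact: bz.
  have [nk|kn] := leqP n k.+1; first by move=> _; exact: padded_past_end.
  by apply: bz => //=; exact: ltnW.
- move=> m; case: l b bb bl bz binf => [n|] b bb bl bz binf.
    (* The index [m + n.*2] lies past the end, where the digit 0 is below a >= 1. *)
    exists n; rewrite padded_past_end.
      exact: lt_le_trans (cf_digit_ge1 alpha01 alpha_irr _).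
    by rewrite -addnn addnA leq_addl.
  have [oddinf evinf] := binf erefl.
  (* Padded index m + 2j carries the digit b_{m+1+2j}, hence the parity of [m.+1]. *)
  have [k [mk km kb]] : exists k, [/\ (m < k)%N, odd k = odd m.+1
      & digit b k <= cf_digit alpha k - 1].
    have [om|om] := boolP (odd m.+1).
      by have [k [mk ok kb]] := oddinf m.+1; exists k; split.
    by have [k [mk /negbTE ok kb]] := evinf m.+1; exists k; split.
  exists (k - m.+1)./2.
  rewrite even_halfK; last by rewrite oddB// km addbb.
  rewrite /padded /a -addSn subnKC//.
  by rewrite -lezD1 -lerBrDr.
Qed.

(** The length can be read off the padded sequence: a finite string ends in a nonzero digit, and an
    infinite one has nonzero digits arbitrarily far out. *)
Lemma padded_inj l l' (b : digits l) (b' : digits l') :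
  right_admissible alpha b -> right_admissible alpha b' ->
  padded b = padded b' -> existT digits l b = existT digits l' b'.
Proof.
move=> [[_ bl] _ _] [[_ bl'] _ _] bb'.
have lt_false n m (c : digits (Some n)) (c' : digits (Some m)) :
    ((1 <= m)%N -> 1 <= digit c' m) -> padded c = padded c' -> (n < m)%N ->
    False.
  move=> cm cc' nm; case: m => // m in c' cm cc' nm *.
  have := cm isT; have -> : digit c' m.+1 = padded c m by rewrite cc'.
  by rewrite padded_past_end.
have inf_false n (c : digits (Some n)) (c' : digits None) :
    (forall N : nat, exists2 k, (N <= k)%N & 1 <= digit c' k) ->
    padded c = padded c' -> False.
  move=> cm cc'; have [[//|k] nk] := cm n.+1.
  have -> : digit c' k.+1 = padded c k by rewrite cc'.
  by rewrite padded_past_end.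
case: l l' b b' bl bl' bb' => [n|] [m|] b b' bl bl' bb'.
- case: (ltngtP n m) => [nm|mn|nm].
  + by case: (lt_false _ _ _ _ bl' bb' nm).
  + by case: (lt_false _ _ _ _ bl (esym bb') mn).
  + case: _ / nm in b' bb' {bl bl'} *; congr existT.
    apply: eq_from_tnth => i; rewrite !(tnth_nth 0).
    exact: (congr1 (fun f : nat -> int => f i) bb').
- by case: (inf_false _ _ _ bl' bb').
- by case: (inf_false _ _ _ bl (esym bb')).
- by congr existT; exact: bb'.
Qed.

Lemma padded_surj (c : nat -> int) : admissible a c ->
  exists2 s : {l : option nat & digits l},
    right_admissible alpha (projT2 s) & padded (projT2 s) = c.
Proof.
move=> [cb cz cinf].
have [inf|fin] := pselect (forall N, exists2 k, (N <= k)%N & c k != 0).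
  exists (existT digits None c) => //=; split=> //=.
  - split=> [[//|k] _|N]; first exact: cb.
    have [k Nk ck] := inf N; exists k.+1; first exact: leqW.
    by have /andP[] := cb k; rewrite le_eqVlt eq_sym (negbTE ck).
  - by move=> [//|k] _ _; exact: cz.
  - move=> _.
    have subinf N : exists k, [/\ (N < k)%N, odd k = odd N.+1
        & digit (c : digits None) k <= cf_digit alpha k - 1].
      have [j cj] := cinf N; exists (N + j.*2).+1; split.
      + by rewrite ltnS leq_addr.
      + by rewrite /= oddD odd_double addbF.
      + by rewrite lerBrDr lezD1.
    (* Starting from 2N yields odd indices, from 2N + 1 even ones. *)
    split=> N.
      have [k [Nk ok ck]] := subinf (N.*2); exists k; split=> //.
        by apply: leq_trans (ltnW Nk); rewrite -addnn leq_addr.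
      by rewrite ok /= odd_double.
    have [k [Nk ok ck]] := subinf (N.*2.+1); exists k; split=> //.
      by apply: leq_trans (ltnW Nk); apply: leqW; rewrite -addnn leq_addr.
    by rewrite ok /= odd_double.
have exN : exists N, `[< forall k, (N <= k)%N -> c k = 0 >].
  apply: contrapT => noN; apply: fin => N; apply: contrapT => nok; apply: noN.
  exists N; apply/asboolP => k Nk; apply: contrapT => ck.
  by apply: nok; exists k => //; apply/eqP.
(* The length is the least index from which [c] vanishes; minimality makes the last digit
   nonzero. *)
have [n /asboolP cn nmin] := ex_minnP exN.
pose b : digits (Some n) := [tuple c i | i < n].
have bE : padded b = c.
  apply/funext => k; have [nk|kn] := leqP n k.
    by rewrite padded_past_end// cn.
  have -> : padded b k = tnth [tuple c i | i < n] (Ordinal kn).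
    by rewrite (tnth_nth 0).
  by rewrite tnth_mktuple.
have digitE k : digit b k.+1 = c k by rewrite -bE.
exists (existT digits (Some n) b) => //; split=> [|k|//].
- split=> [[//|k] _|]; rewrite [projT2 _]/=; first by rewrite digitE; exact: cb.
  case: n => // n in cn nmin b bE digitE * => _; rewrite digitE.
  have [cn0|cn0] := eqVneq (c n) 0.
    suff /nmin : `[< forall k, (n <= k)%N -> c k = 0 >] by rewrite ltnn.
    apply/asboolP => k; rewrite leq_eqVlt => /predU1P[<-//|]; exact: cn.
  by have /andP[] := cb n; rewrite le_eqVlt eq_sym (negbTE cn0).
- by case: k => // k _ _; rewrite [projT2 _]/= !digitE; exact: cz.
Qed.

End Padding.

Theorem theorem3p1 (R : realType) (alpha : R) :
  0 < alpha < 1 -> irrational alpha ->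
  (forall (l : option nat) (b : digits l), right_admissible alpha b ->
     exists2 x : R, 0 <= x < 1 & ostrowski_sum_is alpha b x)
  /\
  (forall beta : R, 0 <= beta < 1 ->
     exists! s : {l : option nat & digits l},
       right_admissible alpha (projT2 s) /\
       ostrowski_sum_is alpha (projT2 s) beta).
Proof.
move=> alpha01 irr.
have a_ge1 := cf_digit_ge1 alpha01 irr.
have D_gt0 := norm_theta_pred_gt0 alpha01 irr.
have D_rec := norm_theta_pred_rec alpha01 irr.
have D0 := norm_theta_pred0 alpha01 irr.
split=> [l b /(padded_admissible alpha01 irr) adm|beta].
  have /cvg_ex[x bx] := psum_is_cvg D_gt0 D_rec adm.
  exists x; last exact/ostrowski_sum_isE.
  have := tail_itv D_gt0 D_rec 0 adm bx.
  by rewrite /psum big_ord0 subr0 D0.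
rewrite -D0 => beta01.
have adm := greedy_admissible a_ge1 D_gt0 D_rec beta01.
have lim := greedy_cvg a_ge1 D_gt0 D_rec beta01.
have [s sadm sE] := padded_surj adm.
exists s; split.
  by split=> //; apply/ostrowski_sum_isE; rewrite sE.
(* A competing string pads to an admissible sequence with the same sum, hence to the greedy
   digits. *)
case: s sadm sE => l b /= badm bE [l' b'] /= [badm' /ostrowski_sum_isE lim'].
have adm' := padded_admissible alpha01 irr badm'.
apply: padded_inj badm badm' _; rewrite bE.
exact: (admissible_inj D_gt0 D_rec adm adm' lim lim').
Qed.
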